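(* Let $\Gamma=(G,\sigma)$ be a signed graph of order $n$ and size $m$ whose underlying graph $G$ is non-bipartite. Let $\lambda_1(\Gamma)\ge\cdots\ge\lambda_n(\Gamma)$ be the eigenvalues of its adjacency matrix. If $\lambda_{1}(\Gamma)\ge\sqrt{m-1}$ and $\lambda_{1}(\Gamma)\ge|\lambda_{n}(\Gamma)|$, then $\Gamma$ contains a balanced triangle, unless $\Gamma$ is switching equivalent to $(C_{5}\cup(n-5)K_{1},+)$.
   Context: A signed graph $\Gamma=(G,\sigma)$ consists of a simple graph $G$ and a map $\sigma:E(G)\to\{+1,-1\}$; its adjacency matrix has $(i,j)$-entry $\sigma(v_iv_j)$ if $v_iv_j\in E(G)$ and $0$ otherwise. A triangle (or any cycle) is balanced if it contains an even number of negative edges. $(H,+)$ denotes the signed graph on $H$ with all edges positive; $C_5\cup(n-5)K_1$ is the 5-cycle together with $n-5$ isolated vertices. For $\theta:V\to\{\pm1\}$, switching gives signs $\sigma^{\theta}(uv)=\theta(u)\sigma(uv)\theta(v)$; two signed graphs on the same underlying graph are switching equivalent if one is obtained from the other by such a switching. *)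

(* Defs.v *)
From HB Require Import structures.
From mathcomp Require Import all_boot all_order all_algebra.
From mathcomp Require Import complex reals.

Set Implicit Arguments.
Unset Strict Implicit.
Unset Printing Implicit Defensive.

Import Order.TTheory GRing.Theory Num.Theory.
Local Open Scope ring_scope.

Record sgraph (V : finType) := SGraph {
  adj : rel V;
  adj_sym : symmetric adj;
  adj_irr : irreflexive adj }.

Definition edges (V : finType) (G : sgraph V) : {set {set V}} :=
  [set [set p.1; p.2] | p : V * V & adj G p.1 p.2].

Definition bipartite (V : finType) (G : sgraph V) : Prop :=
  exists c : V -> bool, forall u v, adj G u v -> c u != c v.

(* A map E(G) -> {+1, -1} is encoded by its set of negative edges. *)
Record signed_graph (V : finType) := SignedGraph {
  ugraph :> sgraph V;
  negative : rel V;
  negative_sym : symmetric negative;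
  negative_adj : subrel negative (adj ugraph) }.

(* Only meaningful when u and v are adjacent. *)
Definition sigma (V : finType) (Gam : signed_graph V) (u v : V) : int :=
  (-1) ^+ negative Gam u v.

Definition adjmx (R : pzRingType) (n : nat) (Gam : signed_graph 'I_n) : 'M[R]_n :=
  \matrix_(i, j) (if adj Gam i j then (sigma Gam i j)%:~R else 0).

Definition balanced_triangle (V : finType) (Gam : signed_graph V) (u v w : V) : bool :=
  [&& adj Gam u v, adj Gam v w, adj Gam w u &
      ~~ odd (negative Gam u v + negative Gam v w + negative Gam w u)%N].

(* theta : V -> {+1, -1} is v |-> (-1) ^+ theta v. *)
Definition switching_equiv (V : finType) (Gam Del : signed_graph V) : Prop :=
  adj Gam =2 adj Del /\
  exists theta : V -> bool, forall u v, adj Gam u v ->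
    sigma Del u v = (-1) ^+ theta u * sigma Gam u v * (-1) ^+ theta v.

Definition signed_iso (V W : finType) (Gam : signed_graph V) (Del : signed_graph W) : Prop :=
  exists2 f : V -> W, bijective f &
    (forall u v, adj Del (f u) (f v) = adj Gam u v) /\
    (forall u v, adj Gam u v -> sigma Del (f u) (f v) = sigma Gam u v).

(* Switching equivalence between unlabelled signed graphs. *)
Definition switching_equiv_iso (V W : finType)
    (Gam : signed_graph V) (Del : signed_graph W) : Prop :=
  exists2 Gam' : signed_graph V, switching_equiv Gam Gam' & signed_iso Gam' Del.

Lemma all_positive_sym (V : finType) : symmetric (fun _ _ : V => false).
Proof. by []. Qed.

Lemma all_positive_adj (V : finType) (H : sgraph V) :
  subrel (fun _ _ : V => false) (adj H).
Proof. by []. Qed.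

Definition all_positive (V : finType) (H : sgraph V) : signed_graph V :=
  SignedGraph (@all_positive_sym V) (@all_positive_adj V H).

Definition C5_rel : rel 'I_5 := fun i j => (j == i.+1 %% 5 :> nat)%N || (i == j.+1 %% 5 :> nat)%N.

Lemma C5_sym : symmetric C5_rel.
Proof. by move=> i j; rewrite /C5_rel orbC. Qed.

Lemma C5_irr : irreflexive C5_rel.
Proof. by case; do 5?case. Qed.

Definition C5 : sgraph 'I_5 := SGraph C5_sym C5_irr.

Definition edgeless (k : nat) : sgraph 'I_k :=
  @SGraph 'I_k (fun _ _ => false) (fun _ _ => erefl) (fun _ => erefl).

Definition union_rel (V W : finType) (G : sgraph V) (H : sgraph W) : rel (V + W) :=
  fun x y => match x, y with
             | inl u, inl v => adj G u v
             | inr u, inr v => adj H u v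
             | _, _ => false
             end.

Lemma union_sym (V W : finType) (G : sgraph V) (H : sgraph W) :
  symmetric (union_rel G H).
Proof. by case=> u [] v //=; exact: adj_sym. Qed.

Lemma union_irr (V W : finType) (G : sgraph V) (H : sgraph W) :
  irreflexive (union_rel G H).
Proof. by case=> u /=; exact: adj_irr. Qed.

Definition disjoint_union (V W : finType) (G : sgraph V) (H : sgraph W) :
    sgraph (V + W)%type :=
  SGraph (union_sym G H) (union_irr G H).

(* The eigenvalues of A, with multiplicity, in nonincreasing order. *)
Definition is_spectrum (R : realType) (n : nat) (A : 'M[R]_n) (s : n.-tuple R) : Prop :=
  sorted >=%R s /\ char_poly A = \prod_(x <- s) ('X - x%:P).

Lemma adjmx_tr (R : pzRingType) (n : nat) (Gam : signed_graph 'I_n) :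
  (adjmx R Gam)^T = adjmx R Gam.
Proof.
by apply/matrixP=> i j; rewrite !mxE /sigma adj_sym negative_sym.
Qed.

Lemma adjmx_spectrum (R : realType) (n : nat) (Gam : signed_graph 'I_n) :
  exists s : n.-tuple R, is_spectrum (adjmx R Gam) s.
Proof.
set A := adjmx R Gam; pose f := real_complex R; pose B := map_mx f A.
have BH : B \is hermsymmx.
  apply: realsym_hermsym.
    apply/is_hermitianmxP; rewrite expr0 scale1r.
    by apply/matrixP=> i j; rewrite !mxE /sigma adj_sym negative_sym.
  by apply/mxOverP=> i j; rewrite mxE; apply/complex_realP; exists (A i j).
have /mxOverP dR := hermitian_spectral_diag_real BH.
have eB := orthomx_spectralP (hermitian_normalmx BH).
set d := spectral_diag B in dR eB.
pose t := [tuple complex.Re (d 0 i) | i < n].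
exists (sort_tuple >=%R t); split; first by apply: sort_sorted => x y; exact: le_total.
rewrite (perm_big t) /=; last by rewrite perm_sort.
apply: (@map_poly_inj _ _ f); rewrite map_char_poly -/B rmorph_prod /= big_map big_enum /=.
have PU := spectral_unit B; set P := spectralmx B in PU eB.
have -> : char_poly B = char_poly (diag_mx d).
  pose Q := map_mx polyC P; pose Q' := map_mx polyC (invmx P).
  have QQ : Q' *m Q = 1%:M by rewrite -map_mxM mulVmx ?map_mx1.
  have -> : char_poly B = \det (Q' *m char_poly_mx (diag_mx d) *m Q).
    rewrite /char_poly /char_poly_mx {1}eB !map_mxM -/Q -/Q'.
    by rewrite mulmxBr mulmxBl -(mulmxA Q' 'X%:M) -(scalar_mxC 'X Q) (mulmxA Q') QQ mul1mx.
  by rewrite !det_mulmx mulrAC -det_mulmx QQ det1 mul1r.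
rewrite char_poly_trig ?diag_mx_is_trig //; apply: eq_bigr => i _.
rewrite mxE eqxx mulr1n rmorphB /= map_polyX map_polyC /=; congr (_ - _%:P).
by rewrite RRe_real.
Qed.

(* Main.v *)
(** If the underlying graph is triangle-free, let [x] be an eigenvector for
    [lambda_1] and [v] a vertex where [|x|] is maximal.  Expanding
    [lambda_1^2 x_v] along walks of length two bounds [lambda_1^2] by the number
    of edges meeting the neighbourhood of [v]; non-bipartiteness provides an edge
    missing it, so [lambda_1^2 <= m - 1].  Equality forces exactly one edge to
    miss the neighbourhood of [v], and [|x|] to be maximal at distance two from
    [v] as well; applied at three vertices of a 5-cycle this leaves only [C_5],
    and the signs of [x] give the switching.

    If there is a triangle but no balanced one, then the trace of [A^3] is
    negative, while interlacing with an unbalanced triangle (eigenvalues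
    [1, 1, -2]) gives [lambda_2 >= 1].  The other eigenvalues have squares
    summing to at most [lambda_1^2 + 1] and modulus at most [lambda_1], so by
    convexity their cubes sum to at least [- lambda_1^3 - 1]: the trace of [A^3]
    is nonnegative, a contradiction. *)

Require Import Defs.
From mathcomp Require Import all_boot all_order all_algebra.
From mathcomp Require Import reals.
From mathcomp Require Import complex ring lra.
Import Order.TTheory GRing.Theory Num.Theory.
Local Open Scope ring_scope.

Set Implicit Arguments.
Unset Strict Implicit.
Unset Printing Implicit Defensive.

(** * Counting edges that miss a neighbourhood *)

Definition darts (V : finType) (G : sgraph V) : {set V * V} :=
  [set p | adj G p.1 p.2].

(** An edge missing the neighbourhood of [v] occurs here twice, once per orientation, so a bound by
    2 means at most one such edge. *)
Definition far_darts (V : finType) (G : sgraph V) (v : V) : {set V * V} :=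
  [set p in darts G | ~~ adj G v p.1 & ~~ adj G v p.2].

Definition triangle_free (V : finType) (G : sgraph V) : Prop :=
  forall u v w, adj G u v -> adj G v w -> adj G w u -> False.

Lemma adj_neq (V : finType) (G : sgraph V) u v : adj G u v -> u != v.
Proof. by apply: contraTneq => ->; rewrite adj_irr. Qed.

Lemma set2_eq (V : finType) (a b u v : V) : u != v ->
  ([set a; b] == [set u; v]) = ((a, b) \in [set (u, v); (v, u)]).
Proof.
move=> uv; rewrite !inE !xpair_eqE; apply/eqP/idP; last first.
  by case/orP=> /andP[/eqP-> /eqP->] //; rewrite setUC.
move/setP=> E; have := E u; have := E v; have := E a; have := E b.
rewrite !inE !eqxx ?orbT /= [u == a]eq_sym [u == b]eq_sym [v == a]eq_sym [v == b]eq_sym.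
case: (eqVneq a u) => [-> | au]; case: (eqVneq b v) => [-> // | bv] //=.
- by rewrite (negPf uv).
- by move=> _ <- _ ->.
- by move=> _ <- _ ->.
Qed.

(** The ends of an edge differ, so each fibre of [(u, v) |-> {u, v}] consists of exactly two
    darts. *)
Lemma card_darts (V : finType) (G : sgraph V) :
  #|darts G| = (#|edges G|).*2.
Proof.
pose f (p : V * V) := [set p.1; p.2].
have -> : edges G = f @: darts G.
  by apply/setP=> e; apply/imsetP/imsetP=> -[p]; rewrite ?inE => pG ->; exists p; rewrite ?inE.
rewrite -sum1_card (partition_big_imset f) /= -muln2 -sum_nat_const.
apply: eq_bigr => _ /imsetP[[u v] + ->]; rewrite inE /= => uv.
have nuv := adj_neq uv.
rewrite sum1_card -[RHS](_ : #|[set (u, v); (v, u)]| = 2%N); last first.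
  by rewrite cards2 xpair_eqE (negPf nuv).
apply: eq_card => -[a b]; rewrite unfold_in /= /f /= set2_eq // inE /=.
rewrite andb_idl // !inE !xpair_eqE.
by case/orP=> /andP[/eqP-> /eqP->] //; rewrite adj_sym.
Qed.

Lemma card_darts_sum (V : finType) (G : sgraph V) (P : pred V) :
  #|[set p in darts G | P p.1]| = (\sum_(u | P u) #|adj G u|)%N.
Proof.
rewrite -sum1_card (eq_bigr (fun u => \sum_(w | adj G u w) 1)%N); last first.
  by move=> u _; rewrite sum1_card.
rewrite pair_big_dep /=; apply: eq_bigl => -[u w].
by rewrite !inE /= andbC.
Qed.

(** Without triangles the neighbourhood of [v] is independent, so no dart has both ends in it. The
    darts split into those starting there, those ending there and the far ones; reversal exchanges
    the first two classes. *)
Lemma far_darts_count (V : finType) (G : sgraph V) (v : V) : triangle_free G ->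
  ((\sum_(u | adj G v u) #|adj G u|).*2 + #|far_darts G v| = (#|edges G|).*2)%N.
Proof.
move=> tf; rewrite -card_darts -card_darts_sum -addnn -addnA.
rewrite -(cardsID [set p : V * V | adj G v p.1] (darts G)); congr addn.
  by apply: eq_card => p; rewrite !inE.
rewrite -(cardsID [set p : V * V | adj G v p.2] (_ :\: _)); congr addn; last first.
  by apply: eq_card => p; rewrite !inE; case: adj; case: adj; case: adj.
pose sw (p : V * V) := (p.2, p.1).
have sw_inj : injective sw by move=> [a b] [c d] [-> ->].
set A := [set p in _ | _]; rewrite -(card_imset A sw_inj); apply: eq_card => -[a b].
have -> : ((a, b) \in sw @: A)
   = adj G b a && adj G v b.
  by rewrite -[(a, b)]/(sw (b, a)) (mem_imset _ _ sw_inj) !inE.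
rewrite !inE /= adj_sym; case ab: (adj G a b) => //=; last by rewrite andbF.
case vb: (adj G v b); rewrite /= ?andbF // !andbT; apply/esym/negP=> va.
by apply: (tf v a b) => //; rewrite adj_sym.
Qed.

(** * Forcing a 5-cycle *)

Lemma far_darts_unique (V : finType) (G : sgraph V) (v b c p q : V) :
  (#|far_darts G v| <= 2)%N ->
  adj G b c -> ~~ adj G v b -> ~~ adj G v c ->
  adj G p q -> ~~ adj G v p -> ~~ adj G v q ->
  (p = b /\ q = c) \/ (p = c /\ q = b).
Proof.
move=> far2 bc vb vc pq vp vq.
have /eqP E : [set (b, c); (c, b)] == far_darts G v.
  rewrite eqEcard cards2 xpair_eqE (negPf (adj_neq bc)) far2 andbT.
  by apply/subsetP=> _ /set2P[]->; rewrite !inE /= ?vb ?vc ?bc // adj_sym bc.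
have : (p, q) \in far_darts G v by rewrite !inE /= pq vp vq.
by rewrite -E => /set2P[] [-> ->]; [left | right].
Qed.

(** Otherwise membership in the neighbourhood of [v], an independent set, would be a proper
    2-colouring. *)
Lemma far_dart_exists (V : finType) (G : sgraph V) (v : V) :
  triangle_free G -> ~ bipartite G ->
  exists b c, [/\ adj G b c, ~~ adj G v b & ~~ adj G v c].
Proof.
move=> tf nbip.
have [/existsP[b /existsP[c /and3P[]]] | none] :=
    boolP [exists b, exists c, [&& adj G b c, ~~ adj G v b & ~~ adj G v c]].
  by exists b, c.
case: nbip; exists (adj G v) => p q pq.
move/existsPn/(_ p)/existsPn/(_ q): none; rewrite pq /=.
case vp: (adj G v p); case vq: (adj G v q) => //= _.
by case: (tf v p q); rewrite // adj_sym.
Qed.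

(** If [b] had no neighbour adjacent to [v], colouring by membership in the neighbourhood of [v] and
    then flipping [b] would be proper: the only edge missing that neighbourhood is [bc], and the
    flip separates its ends. *)
Lemma far_dart_attached (V : finType) (G : sgraph V) (v b c : V) :
  triangle_free G -> ~ bipartite G -> (#|far_darts G v| <= 2)%N ->
  adj G b c -> ~~ adj G v b -> ~~ adj G v c ->
  exists2 a, adj G v a & adj G a b.
Proof.
move=> tf nbip far2 bc vb vc.
have [/existsP[a /andP[va ab]] | none] := boolP [exists a, adj G v a && adj G a b].
  by exists a.
have bN a : adj G a b -> ~~ adj G v a.
  by move=> ab; move/existsPn/(_ a): none; rewrite ab andbT.
case: nbip; exists (fun u => adj G v u (+) (u == b)) => p q pq.
have qp : adj G q p by rewrite adj_sym.
case vp: (adj G v p); case vq: (adj G v q) => /=.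
- by case: (tf v p q); rewrite // adj_sym.
- case: (eqVneq p b) => [pb|_]; first by rewrite pb (negPf vb) in vp.
  by case: (eqVneq q b) => // qb; have := bN p; rewrite -qb pq vp => /(_ isT).
- case: (eqVneq q b) => [qb|_]; first by rewrite qb (negPf vb) in vq.
  by case: (eqVneq p b) => // pb; have := bN q; rewrite -pb qp vq => /(_ isT).
- have := @far_darts_unique _ _ v b c p q far2 bc vb vc pq.
  rewrite vp vq => /(_ isT isT)[] [-> ->]; rewrite eqxx;
  by rewrite [c == b]eq_sym (negPf (adj_neq bc)).
Qed.

(** [X] stands for the vertices where the eigenvector has maximal modulus. Walks of length two carry
    [X] from [v] around the cycle [v, a1, b, c, a2]; uniqueness of the far edge at [v], [b] and [c]
    then leaves no further edge. *)
Lemma C5_of_far_darts (V : finType) (G : sgraph V) (X : pred V) (v : V) :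
  triangle_free G -> ~ bipartite G -> X v ->
  (forall u, X u -> #|far_darts G u| <= 2)%N ->
  (forall u w z, X u -> adj G u w -> adj G w z -> X z) ->
  exists f : 'I_5 -> V,
    [/\ injective f, forall i, X (f i),
        forall i j, adj G (f i) (f j) = C5_rel i j
      & forall p q, adj G p q -> exists i j, p = f i /\ q = f j].
Proof.
move=> tf nbip Xv far2 X2.
have [b [c [bc vb vc]]] := far_dart_exists v tf nbip.
have cb : adj G c b by rewrite adj_sym.
have [a1 va1 a1b] := far_dart_attached tf nbip (far2 v Xv) bc vb vc.
have [a2 va2 a2c] := far_dart_attached tf nbip (far2 v Xv) cb vc vb.
have tfN x y z : adj G x y -> adj G y z -> adj G x z = false.
  by move=> xy yz; apply/negP=> xz; apply: (tf x y z) => //; rewrite adj_sym.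
have sym : forall x y, adj G x y -> adj G y x by move=> x y; rewrite adj_sym.
have Xb : X b by apply: (X2 v a1).
have Xc : X c by apply: (X2 v a2).
have Xa2 : X a2 by apply: (X2 b c) => //; apply: sym.
have Xa1 : X a1 by apply: (X2 c b) => //; apply: sym.
have ba2 : adj G b a2 = false by apply: (tfN b c); rewrite // sym.
have ca1 : adj G c a1 = false by apply: (tfN c b); rewrite // sym.
have a12 : adj G a1 a2 = false by apply: (tfN a1 v); rewrite // sym.
have bv : adj G b v = false by rewrite adj_sym (negPf vb).
have cv : adj G c v = false by rewrite adj_sym (negPf vc).
(* The unique far edges: [bc] for [v], [v a2] for [b], [v a1] for [c]. *)
have Ev p q : adj G p q -> ~~ adj G v p -> ~~ adj G v q ->
    (p = b /\ q = c) \/ (p = c /\ q = b).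
  by apply: far_darts_unique => //; apply: far2.
have Eb p q : adj G p q -> ~~ adj G b p -> ~~ adj G b q ->
    (p = v /\ q = a2) \/ (p = a2 /\ q = v).
  by apply: far_darts_unique; rewrite ?bv ?ba2 //; apply: far2.
have Ec p q : adj G p q -> ~~ adj G c p -> ~~ adj G c q ->
    (p = v /\ q = a1) \/ (p = a1 /\ q = v).
  by apply: far_darts_unique; rewrite ?cv ?ca1 //; apply: far2.
(* If [p] is not adjacent to [b], the edge [vp] is far from [b] and [p = a2]; if not adjacent to
   [c], likewise [p = a1]. Adjacency to both would give a triangle [b c p]. *)
have Nv p : adj G v p -> p = a1 \/ p = a2.
  move=> vp; case bp: (adj G b p); last first.
    by case: (Eb v p vp); rewrite ?bv ?bp // => -[E1 E2]; right; rewrite // E2 -E1.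
  case cp: (adj G c p); last first.
    by case: (Ec v p vp); rewrite ?cv ?cp // => -[E1 E2]; left; rewrite // E2 -E1.
  by have := tfN b c p bc cp; rewrite bp.
have Na1 q : adj G a1 q -> q = v \/ q = b.
  move=> aq; case cq: (adj G c q); last first.
    by case: (Ec a1 q aq); rewrite ?ca1 ?cq // => -[E1 E2]; left; rewrite // E2 E1.
  have vq : adj G v q = false by apply: tfN va1 aq.
  by case: (Ev c q cq); rewrite ?vq // => -[E1 E2]; right; rewrite // E2 E1.
have Na2 q : adj G a2 q -> q = v \/ q = c.
  move=> aq; case bq: (adj G b q); last first.
    by case: (Eb a2 q aq); rewrite ?ba2 ?bq // => -[E1 E2]; left; rewrite // E2 E1.
  have vq : adj G v q = false by apply: tfN va2 aq.
  by case: (Ev b q bq); rewrite ?vq // => -[E1 E2]; right; rewrite // E2 E1.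
have Nb q : adj G b q -> q = a1 \/ q = c.
  move=> bq; case vq: (adj G v q).
    by case: (Nv q vq) => E; [left | move: bq; rewrite E ba2].
  by case: (Ev b q bq); rewrite ?vq // => -[E1 E2]; right; rewrite // E2 E1.
have Nc q : adj G c q -> q = a2 \/ q = b.
  move=> cq; case vq: (adj G v q).
    by case: (Nv q vq) => E; [move: cq; rewrite E ca1 | left].
  by case: (Ev c q cq); rewrite ?vq // => -[E1 E2]; right; rewrite // E2 E1.
(* Cyclic order, so that positions match [C5_rel]. *)
pose s := [:: v; a1; b; c; a2].
have us : uniq s.
  have nvb : v != b by apply: contraNneq vc => ->.
  have nvc : v != c by apply: contraNneq vb => ->.
  have n1c : a1 != c by apply: contraNneq vc => <-.
  have nb2 : b != a2 by apply: contraNneq vb => ->.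
  have n12 : a1 != a2.
    by apply: contraTneq a1b => ->; rewrite adj_sym ba2.
  rewrite /s /= !inE !negb_or nvb nvc n1c nb2 n12 (adj_neq va1) (adj_neq va2).
  by rewrite (adj_neq a1b) (adj_neq bc) eq_sym (adj_neq a2c).
have sIn p q : adj G p q -> p \in s.
  move=> pq; have qp := sym _ _ pq; rewrite !inE.
  case vp: (adj G v p); first by case: (Nv p vp) => ->; rewrite eqxx ?orbT.
  case vq: (adj G v q); last first.
    by case: (Ev p q pq); rewrite ?vp ?vq // => -[-> _]; rewrite eqxx ?orbT.
  case: (Nv q vq) => E; rewrite E in qp.
    by case: (Na1 p qp) => ->; rewrite eqxx ?orbT.
  by case: (Na2 p qp) => ->; rewrite eqxx ?orbT.
exists (fun i : 'I_5 => nth v s i); split.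
- by move=> i j /eqP; rewrite nth_uniq // => /eqP /val_inj.
- by case; do 5?case.
- have [a1v a2v ba1 ca2] : [/\ adj G a1 v, adj G a2 v, adj G b a1 & adj G c a2].
    by split; apply: sym.
  have [a21 a2b a1c] : [/\ adj G a2 a1 = false, adj G a2 b = false & adj G a1 c = false].
    by split; rewrite adj_sym.
  case=> [[|[|[|[|[|//]]]]] ?] [[|[|[|[|[|//]]]]] ?] //=; rewrite /C5_rel /= ?adj_irr ?(negPf vb) ?(negPf vc) //.
- move=> p q pq.
  have ps := sIn p q pq; have qs := sIn q p (sym _ _ pq).
  have pi : (index p s < 5)%N by rewrite -[5%N]/(size s) index_mem.
  have qi : (index q s < 5)%N by rewrite -[5%N]/(size s) index_mem.
  by exists (Ordinal pi), (Ordinal qi); rewrite /= !nth_index.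
Qed.

(** * Extremal eigenvectors in the triangle-free case *)

Lemma adjmx_abs (R : realDomainType) (n : nat) (Gam : signed_graph 'I_n) i j :
  `|adjmx R Gam i j| = (adj Gam i j)%:R.
Proof.
rewrite mxE; case: adj; last by rewrite normr0.
by rewrite /sigma; case: negative; rewrite ?expr0 ?expr1 ?normrN1 ?normr1.
Qed.

Lemma eigen_row (R : comNzRingType) (n : nat) (A : 'M[R]_n) (x : 'rV[R]_n) (l : R) j :
  x *m A = l *: x -> l * x 0 j = \sum_i x 0 i * A i j.
Proof. by move/matrixP/(_ 0 j); rewrite !mxE. Qed.

Lemma adjmx_sum_le (R : realDomainType) (n : nat) (Gam : signed_graph 'I_n)
    (x : 'rV[R]_n) (l : R) v :
  x *m adjmx R Gam = l *: x ->
  `|l| * `|x 0 v| <= \sum_(u | adj Gam v u) `|x 0 u|.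
Proof.
move/(eigen_row v); rewrite -normrM => ->.
apply: le_trans (ler_norm_sum _ _ _) _.
rewrite [leRHS]big_mkcond; apply: ler_sum => u _.
by rewrite normrM adjmx_abs adj_sym; case: adj; rewrite ?mulr1 ?mulr0.
Qed.

(* Every step below is an equality in the extremal case, which forces the
   maximal modulus to propagate to all vertices at distance two. *)
Lemma max_entry_extremal (R : realFieldType) (n : nat) (Gam : signed_graph 'I_n)
    (x : 'rV[R]_n) (l M : R) v :
  triangle_free Gam -> ~ bipartite Gam ->
  x *m adjmx R Gam = l *: x ->
  0 < M -> (forall u, `|x 0 u| <= M) -> `|x 0 v| = M ->
  (#|edges Gam|)%:R - 1 <= l ^+ 2 ->
  [/\ (#|far_darts Gam v| <= 2)%N,
      (\sum_(u | adj Gam v u) #|adj Gam u|)%:R <= l ^+ 2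
    & forall u w, adj Gam v u -> adj Gam u w -> `|x 0 w| = M].
Proof.
move=> tf nbip eig M0 leM xv lm.
have [b [c [bc vb vc]]] := far_dart_exists v tf nbip.
have far2 : (2 <= #|far_darts Gam v|)%N.
  have <- : #|[set (b, c); (c, b)]| = 2%N.
    by rewrite cards2 xpair_eqE (negPf (adj_neq bc)).
  apply: subset_leq_card.
  by apply/subsetP=> _ /set2P[]->; rewrite !inE /= ?vb ?vc ?bc // adj_sym bc.
have cnt := far_darts_count v tf.
set D := (\sum_(u | adj Gam v u) #|adj Gam u|)%N in cnt *.
have Dm : (D < #|edges Gam|)%N.
  by rewrite -ltn_double -cnt -[ltnLHS]addn0 ltn_add2l; apply: leq_trans far2.
have up : l ^+ 2 * M <= \sum_(u | adj Gam v u) \sum_(w | adj Gam u w) `|x 0 w|.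
  rewrite -xv -real_normK ?num_real // expr2 -mulrA.
  apply: le_trans (ler_wpM2l (normr_ge0 l) (adjmx_sum_le v eig)) _.
  by rewrite mulr_sumr; apply: ler_sum => u _; exact: adjmx_sum_le.
have DM : \sum_(u | adj Gam v u) \sum_(w | adj Gam u w) M = D%:R * M.
  rewrite /D natr_sum mulr_suml; apply: eq_bigr => u _.
  by rewrite sumr_const mulr_natl.
have slack : \sum_(u | adj Gam v u) \sum_(w | adj Gam u w) (M - `|x 0 w|) =
    D%:R * M - \sum_(u | adj Gam v u) \sum_(w | adj Gam u w) `|x 0 w|.
  rewrite -DM -sumrB; apply: eq_bigr => u _; by rewrite -sumrB.
have slack_ge0 u : 0 <= \sum_(w | adj Gam u w) (M - `|x 0 w|).
  by apply: sumr_ge0 => w _; rewrite subr_ge0.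
have slack0 : 0 <= \sum_(u | adj Gam v u) \sum_(w | adj Gam u w) (M - `|x 0 w|).
  by apply: sumr_ge0 => u _.
(* With [m] edges: [D + 1 <= m] by the existing far edge, [l ^+ 2 <= D] by the walk estimate and
   [m - 1 <= l ^+ 2] by hypothesis, so all three are equalities. *)
have Dm' : D%:R + 1 <= (#|edges Gam|)%:R :> R by rewrite natr1 ler_nat.
have lD : l ^+ 2 <= D%:R.
  by rewrite -(ler_pM2r M0); rewrite slack subr_ge0 in slack0; apply: le_trans slack0.
have mD : (#|edges Gam|)%:R <= (D.+1)%:R :> R by rewrite -natr1; lra.
split.
- by rewrite ler_nat in mD; rewrite -(leq_add2l D.*2) cnt addn2 -doubleS leq_double.
- lra.
- move=> u w vu uw.
  have E0 : \sum_(u | adj Gam v u) \sum_(w | adj Gam u w) (M - `|x 0 w|) = 0.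
    apply/eqP; rewrite eq_le slack0 andbT slack subr_le0; apply: le_trans up.
    by rewrite ler_pM2r //; lra.
  have /eqP := psumr_eq0P (fun u _ => slack_ge0 u) E0 vu.
  rewrite psumr_eq0; last by move=> z _; rewrite subr_ge0.
  by move/allP/(_ w (mem_index_enum w)); rewrite uw subr_eq0 => /eqP.
Qed.

Lemma card_C5_rel (i : 'I_5) : #|C5_rel i| = 2%N.
Proof.
by rewrite -sum1_card big_mkcond !big_ord_recl big_ord0; case: i => [[|[|[|[|[|//]]]]] ?].
Qed.

Lemma C5_degree (V : finType) (G : sgraph V) (f : 'I_5 -> V) i :
  injective f ->
  (forall i j, adj G (f i) (f j) = C5_rel i j) ->
  (forall p q, adj G p q -> exists i j, p = f i /\ q = f j) ->
  #|adj G (f i)| = 2%N.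
Proof.
move=> f_inj fE fsub; rewrite -(card_C5_rel i) -(card_imset _ f_inj).
apply: eq_card => q; apply/idP/imsetP => [iq | [j ij ->]]; last by move: ij; rewrite /in_mem /= fE.
have [j [k [Ej Eq]]] := fsub _ _ iq; exists k => //.
by rewrite /in_mem /= -fE -Eq.
Qed.

(** Enumerating the vertices off the image of [f], all isolated, extends [f] to a bijection [g] from
    the disjoint union; its inverse is the isomorphism. *)
Lemma all_positive_C5_iso (n : nat) (G : sgraph 'I_n) (f : 'I_5 -> 'I_n) :
  injective f ->
  (forall i j, adj G (f i) (f j) = C5_rel i j) ->
  (forall p q, adj G p q -> exists i j, p = f i /\ q = f j) ->
  signed_iso (all_positive G) (all_positive (disjoint_union C5 (edgeless (n - 5)))).
Proof.
move=> f_inj fE fsub.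
pose S := ~: (f @: 'I_5).
have cS : #|S| = (n - 5)%N.
  by rewrite cardsCs setCK card_ord card_imset // cardT size_enum_ord.
pose g (y : 'I_5 + 'I_(n - 5)) : 'I_n :=
  match y with inl i => f i | inr k => enum_val (cast_ord (esym cS) k) end.
have gS k : g (inr k) \notin f @: 'I_5.
  by have := enum_valP (cast_ord (esym cS) k); rewrite inE.
have fS i : f i \in f @: 'I_5 by apply: imset_f.
have g_inj : injective g.
  move=> [i|k] [j|l] //= E.
  - by rewrite (f_inj _ _ E).
  - by have := gS l; rewrite /= -E fS.
  - by have := gS k; rewrite /= E fS.
  - by move/enum_val_inj/cast_ord_inj: E => ->.
have n5 : (5 <= n)%N by have := leq_card f f_inj; rewrite !card_ord.
have [h gh hg] : bijective g.
  by apply: inj_card_bij => //; rewrite card_sum !card_ord subnKC.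
exists h; first by exists g.
split=> // u v; rewrite -{2}(hg u) -{2}(hg v).
case: (h u) => [i|k]; case: (h v) => [j|l] //=.
- by apply/esym/negP=> /fsub[i' [j' [_ E]]]; have := gS l; rewrite /= E fS.
- by apply/esym/negP=> /fsub[i' [j' [E _]]]; have := gS k; rewrite /= E fS.
- by apply/esym/negP=> /fsub[i' [j' [E _]]]; have := gS k; rewrite /= E fS.
Qed.

(** In the eigenvalue equation at [v], multiplied by [x 0 v], each of the [#|adj Gam v|] terms is at
    most [M ^+ 2] while their sum is [l * M ^+ 2]. Hence every term equals [M ^+ 2], which is
    positive. *)
Lemma tight_vertex_signs (R : realFieldType) (n : nat) (Gam : signed_graph 'I_n)
    (x : 'rV[R]_n) (l M : R) v u :
  x *m adjmx R Gam = l *: x ->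
  0 < M -> (forall u, `|x 0 u| <= M) -> `|x 0 v| = M ->
  (#|adj Gam v|)%:R <= l -> adj Gam v u ->
  0 < x 0 u * adjmx R Gam u v * x 0 v.
Proof.
move=> eig M0 leM xv dl vu.
have vM : x 0 v ^+ 2 = M ^+ 2 by rewrite -xv real_normK ?num_real.
have term w : adj Gam v w -> 0 <= M ^+ 2 - x 0 w * adjmx R Gam w v * x 0 v.
  move=> vw; rewrite subr_ge0; apply: le_trans (ler_norm _) _.
  rewrite !normrM adjmx_abs adj_sym vw mulr1 xv expr2.
  by rewrite ler_pM2r.
have tot : \sum_(w | adj Gam v w) x 0 w * adjmx R Gam w v * x 0 v = l * M ^+ 2.
  rewrite -vM expr2 mulrA (eigen_row v eig) mulr_suml [LHS]big_mkcond.
  apply: eq_bigr => w _; case vw: (adj Gam v w) => //.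
  by rewrite mxE adj_sym vw mulr0 mul0r.
have slack : \sum_(w | adj Gam v w) (M ^+ 2 - x 0 w * adjmx R Gam w v * x 0 v) = 0.
  apply/eqP; rewrite eq_le sumr_ge0 ?andbT //.
  by rewrite sumrB tot sumr_const -mulr_natl subr_le0 ler_wpM2r ?sqr_ge0.
have /eqP := psumr_eq0P term slack vu.
by rewrite subr_eq0 => /eqP <-; rewrite exprn_gt0.
Qed.

Lemma triangle_free_extremal (R : realType) (n : nat) (Gam : signed_graph 'I_n)
    (x : 'rV[R]_n) (l : R) :
  triangle_free Gam -> ~ bipartite Gam ->
  x *m adjmx R Gam = l *: x -> x != 0 -> 0 <= l ->
  (#|edges Gam|)%:R - 1 <= l ^+ 2 ->
  switching_equiv_iso Gam (all_positive (disjoint_union C5 (edgeless (n - 5)))).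
Proof.
move=> tf nbip eig x0 l0 lm.
have [i0 xi0] : exists i, x 0 i != 0 by apply/rV0Pn.
have [v vmax] : exists v, forall u, `|x 0 u| <= `|x 0 v|.
  exists [arg max_(i > i0) `|x 0 i|]%O.
  by case: arg_maxP => // i _ H u; apply: H.
set M := `|x 0 v| in vmax.
have M0 : 0 < M by apply: lt_le_trans (vmax i0); rewrite normr_gt0.
have ext u : `|x 0 u| = M -> _ :=
  fun xu => max_entry_extremal tf nbip eig M0 vmax xu lm.
have [f [f_inj fX fE fsub]] :
  exists f : 'I_5 -> 'I_n,
    [/\ injective f, forall i, `|x 0 (f i)| == M,
        forall i j, adj Gam (f i) (f j) = C5_rel i j
      & forall p q, adj Gam p q -> exists i j, p = f i /\ q = f j].
  apply: (@C5_of_far_darts _ _ (fun u => `|x 0 u| == M) v) => //.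
    by move=> u /eqP /ext[].
  by move=> u w z /eqP /ext[_ _ H] uw wz; apply/eqP/(H w).
have deg i : #|adj Gam (f i)| = 2%N by exact: C5_degree.
(* Both neighbours of [f 0] have degree 2, so the degree sum bounded by [l ^+ 2] is 4. *)
have l2 : 2%:R <= l.
  have [_ + _] := ext _ (eqP (fX 0)).
  rewrite (eq_bigr (fun=> 2%N)); last first.
    by move=> u /fsub[i [j [_ ->]]].
  rewrite sum_nat_const (_ : #|_| = 2%N) ?deg //.
  by rewrite natrM -expr2 ler_sqr ?nnegrE.
exists (all_positive Gam); last exact: all_positive_C5_iso fsub.
(* Switching by the signs of [x]: on the cycle the degree 2 is at most [l], so each edge sign is the
   product of the signs of [x] at its ends. *)
split=> //; exists (fun u => x 0 u < 0) => u v' uv.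
have [i [j [ui vj]]] := fsub _ _ uv.
have : 0 < x 0 v' * adjmx R Gam v' u * x 0 u.
  by apply: (@tight_vertex_signs _ _ _ _ l M) => //; rewrite ui ?deg //; apply/eqP.
rewrite mxE adj_sym uv /sigma negative_sym /=.
have [xu | xu] := ltP (x 0 u) 0; have [xv | xv] := ltP (x 0 v') 0;
  case: negative; rewrite /= ?expr0 ?expr1 => H //;
  exfalso; move: H; rewrite ?mulrN1 ?mulr1 ?mulrN; nra.
Qed.

(** * Bounding sums of cubes by sums of squares *)

(** Convexity of [t |-> t^(3/2)] at the squares: since [1 <= a] and [b <= l], the chord slope
    [(b^3 - 1) / (b^2 - 1)] is at most [(l^3 - a^3) / (l^2 - a^2)]. Cancelled and cross-multiplied,
    this is [mono]. *)
Lemma cubes_le_of_squares_le (R : realDomainType) (a b l : R) :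
  1 <= a -> 1 <= b -> a <= l -> b <= l -> a ^+ 2 + b ^+ 2 <= l ^+ 2 + 1 ->
  a ^+ 3 + b ^+ 3 <= l ^+ 3 + 1.
Proof.
move=> a1 b1 al bl H.
have mono : (b ^+ 2 + b + 1) * (l + a) <= (l ^+ 2 + l * a + a ^+ 2) * (b + 1).
  (* The difference of the two sides of [mono], expanded in [s = l - b], [t = a - 1] and [c = b],
     has only nonnegative coefficients. *)
  have pos (s t c : R) : 0 <= s -> 0 <= t -> 0 <= c ->
      0 <= s * (c ^+ 2 + 2 * c) + t * (2 * c + 1) + (c + 1) * (s ^+ 2 + s * t + t ^+ 2).
    by move=> *; rewrite !(addr_ge0, mulr_ge0, sqr_ge0).
  have : 0 <= (l - b) * (b ^+ 2 + 2 * b) + (a - 1) * (2 * b + 1)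
      + (b + 1) * ((l - b) ^+ 2 + (l - b) * (a - 1) + (a - 1) ^+ 2).
    by apply: pos; lra.
  lra.
have q0 : 0 <= b ^+ 2 - 1 by rewrite subr_ge0 exprn_ege1.
have prod : (b ^+ 2 - 1) * ((b ^+ 2 + b + 1) * (l + a)) <=
    (l ^+ 2 - a ^+ 2) * ((l ^+ 2 + l * a + a ^+ 2) * (b + 1)).
  apply: ler_pM => //; last by lra.
  by rewrite !(addr_ge0, mulr_ge0, sqr_ge0) // (le_trans ler01) // (le_trans a1).
have pos : 0 < (b + 1) * (l + a) by apply: mulr_gt0; lra.
suff : (b ^+ 3 - 1) * ((b + 1) * (l + a)) <= (l ^+ 3 - a ^+ 3) * ((b + 1) * (l + a)).
  by rewrite (ler_pM2r pos); lra.
rewrite (_ : _ * _ = (b ^+ 2 - 1) * ((b ^+ 2 + b + 1) * (l + a))); last by ring.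
by apply: le_trans prod _; rewrite le_eqVlt; apply/orP; left; apply/eqP; ring.
Qed.

(** If all terms are at most 1, cubes are below squares. Otherwise keep the largest term [f j] and
    let [r] be the sum of the other squares: each other term is at most [Num.sqrt r], so their cubes
    sum to at most [Num.sqrt r ^+ 3], and two variables remain. *)
Lemma sum_cubes_le (R : rcfType) (I : finType) (P : pred I) (f : I -> R) (l : R) :
  1 <= l -> (forall i, 0 <= f i <= l) ->
  \sum_(i | P i) f i ^+ 2 <= l ^+ 2 + 1 ->
  \sum_(i | P i) f i ^+ 3 <= l ^+ 3 + 1.
Proof.
move=> l1 fl sq.
have f0 i : 0 <= f i by case/andP: (fl i).
have cube_le (Q : pred I) (c : R) : (forall i, Q i -> f i <= c) ->
    \sum_(i | Q i) f i ^+ 3 <= c * \sum_(i | Q i) f i ^+ 2.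
  move=> fc; rewrite mulr_sumr; apply: ler_sum => i Qi.
  by rewrite exprS ler_wpM2r ?sqr_ge0 ?fc.
have [/forall_inP f1 | ] := boolP [forall (i | P i), f i <= 1].
  apply: le_trans (cube_le P 1 f1) _; rewrite mul1r; apply: le_trans sq _.
  by rewrite lerD2r ler_weXn2l.
rewrite negb_forall_in => /exists_inP[j0 Pj0]; rewrite -ltNge => fj0.
have [j Pj jmax] : exists2 j, P j & forall i, P i -> f i <= f j.
  exists [arg max_(i > j0 | P i) f i]%O; by case: arg_maxP => // i _ H u; apply: H.
have fj1 : 1 <= f j by apply: le_trans (jmax _ Pj0); apply: ltW.
have fjl : f j <= l by case/andP: (fl j).
rewrite (bigD1 j) //= in sq; rewrite (bigD1 j) //=.
set r := \sum_(i | _) f i ^+ 2 in sq.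
have r0 : 0 <= r by apply: sumr_ge0 => i _; apply: sqr_ge0.
have fr i : P i && (i != j) -> f i <= Num.sqrt r.
  move=> Qi; rewrite -(ler_sqr (f0 i) (sqrtr_ge0 _)) sqr_sqrtr //.
  by rewrite /r (bigD1 i) //= lerDl sumr_ge0 // => k _; apply: sqr_ge0.
have {fr} le3 := cube_le _ _ fr.
have sr : Num.sqrt r ^+ 2 = r by apply: sqr_sqrtr.
rewrite -/r -{2}sr -exprS in le3.
have [r1 | /ltW r1] := leP (Num.sqrt r) 1.
  apply: lerD; first by rewrite lerXn2r ?nnegrE // (le_trans _ l1).
  by apply: le_trans le3 _; rewrite exprn_ile1 ?sqrtr_ge0.
apply: le_trans (lerD (lexx _) le3) _.
apply: cubes_le_of_squares_le => //; last by rewrite sr.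
(* [Num.sqrt r <= l], because [f j ^+ 2 >= 1] leaves [r <= l ^+ 2]. *)
rewrite -ler_sqr ?nnegrE ?sqrtr_ge0 ?(le_trans _ l1) // sr.
have := exprn_ege1 2 fj1; lra.
Qed.

(** * Diagonalization, quadratic forms and traces *)

Local Open Scope sesquilinear_scope.

(** Over [R[i]] the matrix is Hermitian, so the spectral theorem applies and its eigenvalues are
    real; only the unitary [P] needs complex entries. *)
Lemma symmetric_diagonalization (R : realType) (n : nat) (A : 'M[R]_n) : A^T = A ->
  exists (P : 'M[R[i]]_n) (e : 'I_n -> R), P \is unitarymx /\
    map_mx (real_complex R) A = P^t* *m diag_mx (\row_i (e i)%:C%C) *m P.
Proof.
move=> symA; set B := map_mx _ A.
have BH : B \is hermsymmx.
  apply: realsym_hermsym.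
    by apply/is_hermitianmxP; rewrite expr0 scale1r /B -{1}symA; apply/matrixP=> i j; rewrite !mxE.
  by apply/mxOverP=> i j; rewrite mxE; apply/complex_realP; exists (A i j).
have /mxOverP dR := hermitian_spectral_diag_real BH.
have eB := orthomx_spectralP (hermitian_normalmx BH).
exists (spectralmx B), (fun i => complex.Re (spectral_diag B 0 i)).
split; first exact: spectral_unitarymx.
rewrite (_ : \row_i _ = spectral_diag B); last by apply/rowP=> i; rewrite mxE RRe_real.
by rewrite -invmx_unitary ?spectral_unitarymx.
Qed.

(** A Courant-Fischer argument giving a second eigenvalue at least 1. In the coordinates [z] the
    hypothesis reads [\sum_i (1 - d 0 i) * |z 0 i|^2 = 0] with [z 0 i0 = 0]; were all other [d 0 i]
    below 1, [z] would vanish. *)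
Lemma unitary_form_second (C : numClosedFieldType) (n : nat) (P : 'M[C]_n)
    (d : 'rV[C]_n) (y : 'rV[C]_n) (i0 : 'I_n) :
  P \is unitarymx -> (forall i, d 0 i \is Num.real) ->
  y != 0 -> (y *m P^t*) 0 i0 = 0 ->
  y *m (P^t* *m diag_mx d *m P) *m y^t* = y *m y^t* ->
  exists2 i1, i1 != i0 & 1 <= d 0 i1.
Proof.
move=> PU dR y0; set z := y *m P^t* => z0 yB.
have PP : P^t* *m P = 1%:M by rewrite -invmx_unitary // mulVmx // unitarymx_unit.
have zt : z^t* = P *m y^t* by rewrite /z trmx_mul map_mxM /= trmxCK.
have zz : z *m z^t* = y *m y^t* by rewrite zt /z mulmxA -(mulmxA y) PP mulmx1.
have zd : z *m diag_mx d *m z^t* = z *m z^t* by rewrite zz -yB zt /z !mulmxA.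
have [/existsP[i1 /andP[]] | none] := boolP [exists i, (i != i0) && (1 <= d 0 i)].
  by exists i1.
have small i : i != i0 -> d 0 i < 1.
  move=> ii0; move/existsPn/(_ i): none; rewrite ii0 /= -real_ltNge //.
have sum0 : \sum_i (1 - d 0 i) * `|z 0 i| ^+ 2 = 0.
  have /matrixP/(_ 0 0) := zd; rewrite !mxE => /eqP; rewrite -subr_eq0 -sumrB => /eqP E.
  apply/eqP; rewrite -oppr_eq0 -sumrN; apply/eqP; rewrite -[RHS]E; apply: eq_bigr => i _.
  by rewrite mul_mx_diag !mxE normCK; ring.
have ge0 i : true -> 0 <= (1 - d 0 i) * `|z 0 i| ^+ 2.
  have [-> _ | ii0 _] := eqVneq i i0; first by rewrite z0 normr0 expr0n mulr0.
  by rewrite mulr_ge0 ?exprn_ge0 // subr_ge0 ltW // small.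
have z_eq0 : z = 0.
  apply/rowP=> i; rewrite [RHS]mxE; have [-> // | ii0] := eqVneq i i0.
  have /eqP := psumr_eq0P ge0 sum0 (i := i) isT.
  by rewrite mulf_eq0 subr_eq0 gt_eqF ?small //= sqrf_eq0 normr_eq0 => /eqP.
by move/eqP: y0; case; rewrite -[y]mulmx1 -PP mulmxA -/z z_eq0 mul0mx.
Qed.

Lemma mxtrace_square (R : comNzRingType) (n : nat) (A : 'M[R]_n) :
  \tr (A *m A) = \sum_i \sum_j A i j * A j i.
Proof. by apply: eq_bigr => i _; rewrite mxE. Qed.

Lemma mxtrace_cube (R : comNzRingType) (n : nat) (A : 'M[R]_n) :
  \tr (A *m A *m A) = \sum_i \sum_j \sum_k A i j * A j k * A k i.
Proof.
apply: eq_bigr => i _; rewrite mxE exchange_big /=; apply: eq_bigr => k _.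
by rewrite mxE mulr_suml.
Qed.

Lemma mxtrace_conj_diag (R : comNzRingType) (n : nat) (P Q : 'M[R]_n) (d : 'rV[R]_n) :
  P *m Q = 1%:M -> let B := Q *m diag_mx d *m P in
  \tr (B *m B) = \sum_i d 0 i ^+ 2 /\ \tr (B *m B *m B) = \sum_i d 0 i ^+ 3.
Proof.
move=> PQ B; pose D := diag_mx d.
have BM (E : 'M_n) : Q *m E *m P *m B = Q *m (E *m D) *m P.
  by rewrite /B !mulmxA -(mulmxA _ P) PQ mulmx1.
rewrite {1 3}/B !BM /D !mulmx_diag mxtrace_mulC mulmxA PQ mul1mx.
rewrite mxtrace_mulC mulmxA PQ mul1mx !mxtrace_diag.
by split; apply: eq_bigr => i _; rewrite !mxE ?exprSr ?expr0 ?mul1r.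
Qed.

Lemma unitary_diag_eigenvalue (C : numClosedFieldType) (n : nat) (P : 'M[C]_n)
    (d : 'rV[C]_n) (a : C) : P \is unitarymx ->
  eigenvalue (P^t* *m diag_mx d *m P) a = [exists i, d 0 i == a].
Proof.
move=> PU; have PPt : P *m P^t* = 1%:M by apply/unitarymxP.
apply/eigenvalueP/existsP => [[v vB v0] | [i /eqP <-]].
  pose w := v *m P^t*.
  have wd : w *m diag_mx d = a *: w.
    by rewrite /w scalemxAl -vB !mulmxA -(mulmxA _ P) PPt mulmx1.
  have w0 : w != 0.
    apply: contraNneq v0 => w0; rewrite -[v]mulmx1.
    by rewrite -(mulmx1C PPt) mulmxA -/w w0 mul0mx.
  have /rV0Pn[i wi] := w0; exists i; apply/eqP/(mulfI wi).
  by have /rowP/(_ i) := wd; rewrite mul_mx_diag !mxE mulrC => ->; rewrite mulrC.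
exists (row i P).
  rewrite -row_mul !mulmxA PPt mul1mx; apply/rowP=> j.
  by rewrite mul_diag_mx !mxE.
apply/negP=> /eqP r0; have /rowP/(_ i) : row i (P *m P^t*) = 0.
  by rewrite row_mul r0 mul0mx.
by rewrite PPt !mxE eqxx => /eqP; rewrite oner_eq0.
Qed.

(** * Unbalanced triangles in the adjacency matrix *)

Lemma big_support3 (V : nmodType) (I : finType) (F : I -> V) (u v w : I) :
  u != v -> v != w -> w != u ->
  (forall j, j != u -> j != v -> j != w -> F j = 0) ->
  \sum_j F j = F u + F v + F w.
Proof.
move=> uv vw wu F0; rewrite (bigD1 u) //= (bigD1 v) 1?eq_sym //= (bigD1 w) /=; last first.
  by rewrite wu eq_sym.
by rewrite big1 ?addr0 ?addrA // => j /andP[/andP[*]]; apply: F0.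
Qed.

(* An unbalanced triangle switches to [1 - J], so it has a plane of eigenvectors
   for the eigenvalue 1; this plane meets the hyperplane orthogonal to [q]. *)
Lemma unbalanced_triangle_vector (C : numClosedFieldType) (n : nat) (B : 'M[C]_n)
    (q : 'cV[C]_n) (u v w : 'I_n) :
  u != v -> v != w -> w != u ->
  B u u = 0 -> B v v = 0 -> B w w = 0 ->
  B v u = B u v -> B w v = B v w -> B u w = B w u ->
  B u v ^+ 2 = 1 -> B v w ^+ 2 = 1 -> B w u ^+ 2 = 1 ->
  B u v * B v w * B w u = -1 ->
  exists y : 'rV[C]_n, [/\ y != 0, y *m q = 0 & y *m B *m y^t* = y *m y^t*].
Proof.
move=> uv vw wu Buu Bvv Bww Bvu Bwv Buw.
set a := B u v in Bvu *; set b := B v w in Bwv *; set c := B w u in Buw *.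
move=> a2 b2 c2 abc.
have ac : a * c = - b by rewrite -[LHS]mulr1 -b2 -[b in RHS]mul1r -mulNr -abc; ring.
(* On the coordinates [u, v, w] the plane is spanned by [(a, 1, 0)] and [(c, 0, 1)]. Orthogonality
   to [q] is one linear equation in the coefficients [p, r], so it has a nonzero solution. *)
have [p [r [pr pq]]] : exists p r : C, (p != 0) || (r != 0) /\
    p * (a * q u 0 + q v 0) + r * (c * q u 0 + q w 0) = 0.
  set al := a * _ + _; set be := c * _ + _.
  have [/andP[/eqP-> /eqP->] | ] := boolP ((be == 0) && (al == 0)).
    by exists 1, 0; rewrite oner_eq0 !mulr0 addr0.
  by rewrite negb_and -(oppr_eq0 al) => nz; exists be, (- al); split => //; ring.
pose y : 'rV[C]_n := \row_j (if j == u then a * p + c * r else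
                             if j == v then p else if j == w then r else 0).
have yu : y 0 u = a * p + c * r by rewrite mxE eqxx.
have yv : y 0 v = p by rewrite mxE eq_sym (negPf uv) eqxx.
have yw : y 0 w = r by rewrite mxE (negPf wu) eq_sym (negPf vw) eqxx.
have y0 j : j != u -> j != v -> j != w -> y 0 j = 0.
  by rewrite mxE => /negPf-> /negPf-> /negPf->.
have yM k (M : 'M[C]_(n, k)) j :
    (y *m M) 0 j = y 0 u * M u j + y 0 v * M v j + y 0 w * M w j.
  by rewrite mxE; apply: big_support3 => // i *; rewrite y0 ?mul0r.
exists y; split.
- apply: contraTneq pr => yE; move: yv yw; rewrite yE !mxE => <- <-.
  by rewrite eqxx.
- apply/rowP=> j; rewrite ord1 yM yu yv yw mxE.
  by rewrite -[RHS]pq; ring.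
(* Only the columns [u, v, w] of [y *m B] matter, since [y] vanishes elsewhere; on them [B] fixes
   [y]. *)
- apply/rowP=> j; rewrite ord1 yM mxE (@big_support3 _ _ _ u v w) //; last first.
    by move=> i iu iv iw; rewrite !mxE (negPf iu) (negPf iv) (negPf iw) conjC0 mulr0.
  have -> : (y *m B) 0 u = y 0 u by rewrite yM Buu Bvu -/c yu yv yw; ring.
  have -> : (y *m B) 0 v = y 0 v.
    rewrite yM -/a Bvv Bwv yu yv yw.
    rewrite (_ : _ + _ = a ^+ 2 * p + (a * c + b) * r); last by ring.
    by rewrite a2 ac addNr mul0r mul1r addr0.
  have -> : (y *m B) 0 w = y 0 w.
    rewrite yM Buw -/b Bww yu yv yw.
    rewrite (_ : _ + _ = c ^+ 2 * r + (a * c + b) * p); last by ring.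
    by rewrite c2 ac addNr mul0r mul1r addr0.
  by rewrite !mxE.
Qed.

Lemma mxtrace_adjmx_square (R : realDomainType) (n : nat) (Gam : signed_graph 'I_n) :
  \tr (adjmx R Gam *m adjmx R Gam) = (#|edges Gam|).*2%:R.
Proof.
rewrite mxtrace_square -card_darts -sum1_card natr_sum.
rewrite pair_big /= [RHS]big_mkcond; apply: eq_bigr => -[i j] _ /=.
have -> : adjmx R Gam j i = adjmx R Gam i j by rewrite -[in LHS]adjmx_tr mxE.
rewrite -expr2 -real_normK ?num_real // adjmx_abs !inE /=.
by case: adj; rewrite ?expr1n ?expr0n.
Qed.

Lemma unbalanced_product (R : comNzRingType) (n : nat) (Gam : signed_graph 'I_n) u v w :
  adj Gam u v -> adj Gam v w -> adj Gam w u -> ~~ balanced_triangle Gam u v w ->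
  adjmx R Gam u v * adjmx R Gam v w * adjmx R Gam w u = -1.
Proof.
move=> uv vw wu; rewrite /balanced_triangle uv vw wu /= negbK !mxE uv vw wu /sigma.
by do 3![case: negative] => //= _; rewrite ?expr0 ?expr1 ?mulrN1 ?mulr1 ?opprK.
Qed.

(** Each nonzero term of the trace comes from a triangle, which is unbalanced and contributes -1;
    [u v w] supplies one such term. *)
Lemma mxtrace_adjmx_cube_lt0 (R : realDomainType) (n : nat) (Gam : signed_graph 'I_n) u v w :
  (forall u v w, ~~ balanced_triangle Gam u v w) ->
  adj Gam u v -> adj Gam v w -> adj Gam w u ->
  \tr (adjmx R Gam *m adjmx R Gam *m adjmx R Gam) < 0.
Proof.
move=> nb uv vw wu; set A := adjmx R Gam.
have le0 i j k : A i j * A j k * A k i <= 0.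
  have [ij | ij] := boolP (adj Gam i j); last by rewrite mxE (negPf ij) !mul0r.
  have [jk | jk] := boolP (adj Gam j k); last by rewrite [A j k]mxE (negPf jk) mulr0 mul0r.
  have [ki | ki] := boolP (adj Gam k i); last by rewrite [A k i]mxE (negPf ki) mulr0.
  by rewrite unbalanced_product // oppr_le0 ler01.
rewrite mxtrace_cube (bigD1 u) //= (bigD1 v) //= (bigD1 w) //=.
rewrite unbalanced_product //.
have r1 : \sum_(k | k != w) A u v * A v k * A k u <= 0 by apply: sumr_le0.
have r2 : \sum_(j | j != v) \sum_k A u j * A j k * A k u <= 0.
  by apply: sumr_le0 => j _; apply: sumr_le0.
have r3 : \sum_(i | i != u) \sum_j \sum_k A i j * A j k * A k i <= 0.
  by apply: sumr_le0 => i _; apply: sumr_le0 => j _; apply: sumr_le0.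
lra.
Qed.

(** * Excluding triangles through the spectrum *)

Lemma spectrum_bounds (R : realType) (n : nat) (A : 'M[R]_n) (s : n.-tuple R) (a : R) :
  is_spectrum A s -> root (char_poly A) a -> s`_n.-1 <= a <= s`_0.
Proof.
case=> ss ->; rewrite root_prod_XsubC => sa.
have /(nthP 0)[k] := sa; rewrite size_tuple => kn <-.
have nth_le i j : (i <= j)%N -> (j < n)%N -> s`_j <= s`_i.
  move=> ij jn; apply: (sorted_leq_nth ge_trans ge_refl 0 ss) => //; rewrite inE size_tuple //.
  exact: leq_ltn_trans ij jn.
by rewrite !nth_le //; case: n kn {A s ss sa nth_le} => // n; rewrite ltnS.
Qed.

Lemma spectrum_top (R : realType) (n : nat) (A : 'M[R]_n) (s : n.-tuple R) :
  (0 < n)%N -> is_spectrum A s -> root (char_poly A) s`_0.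
Proof. by move=> n0 [_ ->]; rewrite root_prod_XsubC mem_nth ?size_tuple. Qed.

Lemma unbalanced_triangle_free (R : realType) (n : nat) (Gam : signed_graph 'I_n)
    (s : n.-tuple R) :
  is_spectrum (adjmx R Gam) s ->
  (#|edges Gam|)%:R - 1 <= s`_0 ^+ 2 -> `|s`_n.-1| <= s`_0 ->
  (forall u v w, ~~ balanced_triangle Gam u v w) ->
  triangle_free Gam.
Proof.
move=> spec lm ln nb u v w uv vw wu.
set A := adjmx R Gam in spec.
have n0 : (0 < n)%N by apply: leq_ltn_trans (ltn_ord u).
have [P [e [PU BE]]] := symmetric_diagonalization (adjmx_tr R Gam : A^T = A).
set B := map_mx _ A in BE; set d : 'rV_n := \row_i _ in BE.
have PPt : P *m P^t* = 1%:M by apply/unitarymxP.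
have rootE a : root (char_poly A) a = [exists i, e i == a].
  rewrite -(fmorph_root (real_complex R)) map_char_poly -/B.
  rewrite -eigenvalue_root_char BE unitary_diag_eigenvalue //.
  by apply: eq_existsb => i; rewrite mxE (inj_eq (@complexI R)).
have eroot i : root (char_poly A) (e i) by rewrite rootE; apply/existsP; exists i.
have eb i : `|e i| <= s`_0.
  have /andP[lo hi] := spectrum_bounds spec (eroot i).
  rewrite ler_norml hi andbT; apply: le_trans lo.
  by rewrite lerNl; apply: le_trans ln; rewrite -normrN ler_norm.
have [i0 /eqP ei0] : exists i, e i == s`_0.
  by apply/existsP; rewrite -rootE; exact: spectrum_top.
(* A second eigenvalue at least 1: the test vector [y] lives on the unbalanced triangle and has zero
   coordinate along the eigenvector of index [i0]. *)
have [i1 i10 ei1] : exists2 i1, i1 != i0 & 1 <= e i1.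
  have Bsym i j : B j i = B i j by rewrite [LHS]mxE [RHS]mxE /A -[in LHS]adjmx_tr mxE.
  have Bdiag i : B i i = 0 by rewrite mxE /A mxE adj_irr rmorph0.
  have Bsq i j : adj Gam i j -> B i j ^+ 2 = 1.
    by move=> ij; rewrite mxE -rmorphXn -real_normK ?num_real // adjmx_abs ij expr1n rmorph1.
  have Bprod : B u v * B v w * B w u = -1.
    by rewrite [B u v]mxE [B v w]mxE [B w u]mxE -!rmorphM unbalanced_product ?rmorphN1.
  have [y [y0 yq yB]] := @unbalanced_triangle_vector _ _ B (col i0 (P^t*)) u v w
    (adj_neq uv) (adj_neq vw) (adj_neq wu) (Bdiag u) (Bdiag v) (Bdiag w)
    (Bsym u v) (Bsym v w) (Bsym w u) (Bsq _ _ uv) (Bsq _ _ vw) (Bsq _ _ wu) Bprod.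
  have [||||i1 i10 di1] := @unitary_form_second _ _ P d y i0 PU; rewrite -?BE //.
  - by move=> i; rewrite mxE; apply/complex_realP; exists (e i).
  - by move/rowP/(_ 0): yq; rewrite colE mulmxA -colE !mxE.
  by exists i1 => //; move: di1; rewrite mxE -(rmorph1 (real_complex R)) lecR.
have [] := mxtrace_conj_diag d PPt; rewrite -BE => BB BBB.
have tr2 : \sum_i e i ^+ 2 = (#|edges Gam|).*2%:R.
  apply: (@complexI R); rewrite -mxtrace_adjmx_square -trace_map_mx map_mxM -/A -/B BB.
  by rewrite rmorph_sum; apply: eq_bigr => i _; rewrite mxE rmorphXn.
have tr3 : \sum_i e i ^+ 3 < 0.
  rewrite (_ : \sum_i _ = \tr (A *m A *m A)).
    exact: (mxtrace_adjmx_cube_lt0 R nb uv vw wu).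
  apply: (@complexI R); rewrite -trace_map_mx !map_mxM -/B BBB.
  by rewrite rmorph_sum; apply: eq_bigr => i _; rewrite mxE rmorphXn.
have l1 : 1 <= s`_0 by apply: le_trans ei1 (le_trans (ler_norm _) (eb i1)).
(* All squares sum to twice the number of edges, at most [2 * (s]_0 ^+ 2 + 1)[; removing]s[_0 ^+ 2]
   and [e i1 ^+ 2 >= 1] leaves this bound. *)
have sq : \sum_(i | (i != i0) && (i != i1)) `|e i| ^+ 2 <= s`_0 ^+ 2 + 1.
  move: tr2; rewrite (bigD1 i0) //= (bigD1 i1) //= ei0 -addnn natrD => tr2.
  rewrite (eq_bigr (fun i => e i ^+ 2)); last by move=> i _; rewrite real_normK ?num_real.
  have := exprn_ege1 2 ei1; lra.
have cub := sum_cubes_le l1 (fun i => introT andP (conj (normr_ge0 (e i)) (eb i))) sq.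
have lower : - (s`_0 ^+ 3 + 1) <= \sum_(i | (i != i0) && (i != i1)) e i ^+ 3.
  rewrite lerNl -sumrN; apply: le_trans cub; apply: ler_sum => i _.
  by rewrite -normrX -normrN ler_norm.
move: tr3; rewrite (bigD1 i0) //= (bigD1 i1) //= ei0 => tr3.
have := exprn_ege1 3 ei1; lra.
Qed.

(* Combining the triangle-free and the unbalanced case *)
Local Close Scope sesquilinear_scope.
Unset Implicit Arguments.

Theorem theorem1p2 (R : realType) (n m : nat) (Gam : signed_graph 'I_n)
    (lambda : n.-tuple R) :
  m = #|edges Gam| ->
  ~ bipartite Gam ->
  is_spectrum (adjmx R Gam) lambda ->
  Num.sqrt (m%:R - 1) <= lambda`_0 ->
  `|lambda`_n.-1| <= lambda`_0 ->
  ~ switching_equiv_iso Gam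
      (all_positive (disjoint_union C5 (edgeless (n - 5)))) ->
  exists u v w : 'I_n, balanced_triangle Gam u v w.
Proof.
move=> -> nbip spec sq ln nsw.
have [/existsP[u /existsP[v /existsP[w uvw]]] | nb] :=
    boolP [exists u, exists v, exists w, balanced_triangle Gam u v w].
  by exists u, v, w.
have {}nb u v w : ~~ balanced_triangle Gam u v w.
  by apply: contra nb => uvw; do 3![apply/existsP; eexists]; apply: uvw.
have l0 : 0 <= lambda`_0 by apply: le_trans sq; apply: sqrtr_ge0.
have lm : (#|edges Gam|)%:R - 1 <= lambda`_0 ^+ 2.
  (* [Num.sqrt] is 0 at negative arguments, so the edgeless case is treated apart. *)
  have [neg | pos] := ltP ((#|edges Gam|)%:R - 1 : R) 0.
    by apply: le_trans (ltW neg) (sqr_ge0 _).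
  by rewrite -(sqr_sqrtr pos) ler_sqr ?nnegrE ?sqrtr_ge0.
have n0 : (0 < n)%N.
  case: n Gam nbip {lambda spec sq ln nsw nb l0 lm} => // Gam nbip.
  by case: nbip; exists (fun=> true) => -[].
have tf := unbalanced_triangle_free spec lm ln nb.
have := spectrum_top n0 spec; rewrite -eigenvalue_root_char => /eigenvalueP[x eig x0].
by case: nsw; apply: triangle_free_extremal eig x0 l0 lm.
Qed.
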